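(* Let $0<q<1$, let $n\ge1$ be an integer, and let $a,b,c,d$ be nonzero complex numbers such that (H1) $a/b\notin\{q^{j}:-(n+1)\le j\le n+1\}$, $ab\notin\{q^{-j}:0\le j\le n-1\}$, $a^2,b^2\notin\{q^{-j}:1\le j\le 2n-1\}$; (H2) $ac,ad,bc,bd\notin\{q^{-j}:0\le j\le n-1\}$; (H3) $abcd\notin\{q^{1-j}:1\le j\le 2n-1\}$. Set $\alpha=ad/q$, $\beta=bc/q$, $\gamma=q^{-n-1}$, $\delta=a/b$, and $\mu(k)=q^{-k}+\gamma\delta q^{k+1}=q^{-k}+\frac ab q^{k-n}$. Let $A_k(n,m)$ be the connection coefficients defined by $$p_m(x;a,b,c,d\,|\,q)=\sum_{k=0}^{n}A_k(n,m)\,\widetilde{\mathcal B}^{\,n}_k(x;a,b),\qquad 0\le m\le n .$$ Then for all $0\le k,m\le n$ $$A_k(n,m)=\pi_{n,k}\,\omega_{n,m}\,R_m(\mu(k);\alpha,\beta,\gamma,\delta\,|\,q),$$ $$R_m(\mu(k);\alpha,\beta,\gamma,\delta\,|\,q)={}_4\phi_3\!\left[\begin{matrix}q^{-m},\ abcd\,q^{m-1},\ q^{-k},\ \frac ab q^{k-n}\\ ad,\ ac,\ q^{-n}\end{matrix};q,q\right],$$ with $$\pi_{n,k}=\frac{q^{k}}{\binom nk}\begin{bmatrix}n\\k\end{bmatrix}_q\frac{1-\frac ba q^{\,n-2k}}{(ab;q)_n\,(b/a;q)_{n-k}\,\bigl(1-\frac ba q^{\,n-k}\bigr)\,(\frac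 ab q;q)_k},\qquad \omega_{n,m}=a^{-m}(ab;q)_m(ac;q)_m(ad;q)_m .$$ Here $\pi_{n,k}=A_k(n,0)$, i.e. $1=\sum_{k=0}^n\pi_{n,k}\widetilde{\mathcal B}^{\,n}_k$ (so $\pi_{n,k}$ depends only on $n,k,a,b,q$), and $\omega_{n,m}=A_0(n,m)/A_0(n,0)$ is independent of $n$. In particular $$\pi_{n,0}=\frac1{(b/a;q)_n(ab;q)_n},\qquad \pi_{n,n}=\frac1{(a/b;q)_n(ab;q)_n}.$$
   Context: Notation: $(c;q)_0=1$, $(c;q)_k=\prod_{j=0}^{k-1}(1-cq^j)$, $(c_1,\dots,c_r;q)_k=\prod_i (c_i;q)_k$; $\begin{bmatrix}n\\k\end{bmatrix}_q=\frac{(q;q)_n}{(q;q)_k(q;q)_{n-k}}$; ${}_4\phi_3\!\left[\begin{matrix}a_1,\dots,a_4\\ b_1,b_2,b_3\end{matrix};q,z\right]=\sum_{j\ge0}\frac{(a_1,a_2,a_3,a_4;q)_j}{(q,b_1,b_2,b_3;q)_j}z^j$, the sum being terminated at the smallest index at which a numerator factor produced by a parameter $q^{-m}$ or $q^{-k}$ vanishes. With $x=\frac12(z+z^{-1})$, $z=e^{i\theta}$, put $\varphi_k(x;a)=(az,a/z;q)_k=\prod_{j=0}^{k-1}(1-2aq^jx+a^2q^{2j})$ and $\widetilde{\mathcal B}^{\,n}_k(x;a,b)=\binom nk\varphi_k(x;a)\varphi_{n-k}(x;b)$, $0\le k\le n$; under (H1) these form a basis of the space $\Pi_n$ of complex polynomials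 of degree at most $n$ in $x$. The Askey–Wilson polynomials are $$p_m(x;a,b,c,d\,|\,q)=a^{-m}(ab,ac,ad;q)_m\;{}_4\phi_3\!\left[\begin{matrix}q^{-m},\ abcd\,q^{m-1},\ az,\ a/z\\ ab,\ ac,\ ad\end{matrix};q,q\right].$$ The $q$-Racah polynomials are $$R_m(\mu(x);\alpha,\beta,\gamma,\delta\,|\,q)={}_4\phi_3\!\left[\begin{matrix}q^{-m},\ \alpha\beta q^{m+1},\ q^{-x},\ \gamma\delta q^{x+1}\\ \alpha q,\ \beta\delta q,\ \gamma q\end{matrix};q,q\right],\quad \mu(x)=q^{-x}+\gamma\delta q^{x+1}.$$ Convention: apparent singularities of the formula for $\pi_{n,k}$ at special parameter values are interpreted through rational continuation of the complete connection coefficient whenever the connection matrix remains well defined. *)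

(* Defs.v *)
From HB Require Import structures.
From mathcomp Require Import all_boot all_order all_algebra.
From mathcomp Require Import ring.
Set Implicit Arguments.
Unset Strict Implicit.
Unset Printing Implicit Defensive.
Import GRing.Theory.
Local Open Scope ring_scope.

Section BasicHypergeometric.
Variable F : fieldType.
Implicit Types (q a b c d x z : F) (k m n : nat).

Definition qpoch q c k : F := \prod_(j < k) (1 - c * q ^+ j).

Definition qbinom q n k : F :=
  qpoch q q n / (qpoch q q k * qpoch q q (n - k)).

(* The series is cut after the term of index N. In every use below N is the
   last index at which no factor (q^-m; q)_j or (q^-k; q)_j vanishes, which
   also keeps a lower parameter q^-n from producing a zero denominator. *)
Definition phi43 (N : nat) (a1 a2 a3 a4 b1 b2 b3 q z : F) : F :=
  \sum_(j < N.+1)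
    (qpoch q a1 j * qpoch q a2 j * qpoch q a3 j * qpoch q a4 j)
    / (qpoch q q j * qpoch q b1 j * qpoch q b2 j * qpoch q b3 j) * z ^+ j.

(* 'X is x = (z + z^-1) / 2; see [qphiE] for the form (a z, a / z; q)_k. *)
Definition qphi q a k : {poly F} :=
  \prod_(j < k) (1 - (2 * a * q ^+ j) *: 'X + (a ^+ 2 * q ^+ (2 * j))%:P).

Definition bernstein q a b n k : {poly F} :=
  'C(n, k)%:R *: (qphi q a k * qphi q b (n - k)).

(* p_m(x; a, b, c, d | q) at the point x = (z + z^-1) / 2, as a function
   of z. *)
Definition askey_wilson q a b c d m z : F :=
  a ^- m * (qpoch q (a * b) m * qpoch q (a * c) m * qpoch q (a * d) m)
  * phi43 m (q ^- m) (a * b * c * d * q ^ (m%:Z - 1)) (a * z) (a / z)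
      (a * b) (a * c) (a * d) q q.

Definition mu q gamma delta k : F := q ^- k + gamma * delta * q ^+ k.+1.

(* R_m(mu(k); alpha, beta, gamma, delta | q) at a lattice point k : nat; by
   [qracah_muE] it depends on k only through mu(k). *)
Definition qracah q alpha beta gamma delta m k : F :=
  phi43 (minn m k)
    (q ^- m) (alpha * beta * q ^+ m.+1) (q ^- k) (gamma * delta * q ^+ k.+1)
    (alpha * q) (beta * delta * q) (gamma * q) q q.

Definition pi_coef q a b n k : F :=
  q ^+ k / 'C(n, k)%:R * qbinom q n k
  * ((1 - b / a * q ^ (n%:Z - (2 * k)%:Z))
     / (qpoch q (a * b) n * qpoch q (b / a) (n - k)
        * (1 - b / a * q ^+ (n - k)) * qpoch q (a / b * q) k)).

Definition omega_coef q a b c d m : F :=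
  a ^- m * qpoch q (a * b) m * qpoch q (a * c) m * qpoch q (a * d) m.

(* A k m stands for A_k(n, m); only the values at k, m <= n matter. As z runs
   over the nonzero elements of an algebraically closed field, (z + z^-1) / 2
   takes every value, so this is an identity between polynomials in x. *)
Definition connection_coefs q a b c d n (A : nat -> nat -> F) : Prop :=
  forall m, (m <= n)%N -> forall z, z != 0 ->
    askey_wilson q a b c d m z =
    \sum_(k < n.+1) A k m * (bernstein q a b n k).[(z + z^-1) / 2].

Lemma qphiE q a k z : (2 : F) != 0 -> z != 0 ->
  (qphi q a k).[(z + z^-1) / 2] = qpoch q (a * z) k * qpoch q (a / z) k.
Proof.
move=> n2 nz; rewrite horner_prod -big_split /=; apply: eq_bigr => j _.
by rewrite !hornerE mulnC exprM /=; field; rewrite n2 nz.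
Qed.

Lemma qracah_muE q gamma delta k j : q != 0 ->
  qpoch q (q ^- k) j * qpoch q (gamma * delta * q ^+ k.+1) j =
  \prod_(i < j)
    (1 - mu q gamma delta k * q ^+ i + gamma * delta * q ^+ (2 * i).+1).
Proof.
move=> nq; rewrite -big_split; apply: eq_bigr => i _ /=.
by rewrite /mu !exprS mulnC exprM; field; rewrite expf_neq0.
Qed.

End BasicHypergeometric.

(* Main.v *)
(* The basis elements of degree n - 1 are lifted to degree n by writing
   1 = u (1 - 2Ax + A^2) + v (1 - 2Bx + B^2) with A = a q^k, B = b q^(n-1-k);
   induction on n then yields 1 = sum_k 'C(n, k) pi_{n,k} phi_k(a) phi_{n-k}(b).
   Since phi_{j+1}(x; a) = phi_1(x; a) phi_j(x; a q), expanding phi_j(x; a)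
   reduces, by induction on j, to this identity for the pair (a q^j, b).
   Inserting these expansions into the 4phi3 series of p_m and exchanging the
   sums gives the q-Racah form of the coefficients.  They are unique because the
   basis is triangular at the points z = 1 / (a q^k): phi_i(x; a) vanishes there
   for i > k, and H1 makes the k-th basis element nonzero. *)
Require Import Defs.
From mathcomp Require Import all_boot all_order all_algebra.
From mathcomp Require Import reals complex ring zify.
Set Implicit Arguments.
Unset Strict Implicit.
Unset Printing Implicit Defensive.
Import Order.TTheory GRing.Theory Num.Theory.
Local Open Scope ring_scope.

Section Bernstein.
Variables (F : fieldType) (q : F).
Hypotheses (q0 : q != 0) (q_n1 : forall i, (0 < i)%N -> q ^+ i != 1).
Implicit Types (a b : F) (i j k r n : nat).

(** * Recurrences for [qpoch] and [qphi] *)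

Lemma qpoch0 a : qpoch q a 0 = 1.
Proof. by rewrite /qpoch big_ord0. Qed.

Lemma qpochS a k : qpoch q a k.+1 = qpoch q a k * (1 - a * q ^+ k).
Proof. by rewrite /qpoch big_ord_recr. Qed.

Lemma qpochSl a k : qpoch q a k.+1 = (1 - a) * qpoch q (a * q) k.
Proof.
rewrite /qpoch big_ord_recl expr0 mulr1; congr (_ * _).
by apply: eq_bigr => i _; rewrite exprS mulrA.
Qed.

Lemma qpoch_neq0 a k :
  (forall i, (i < k)%N -> a * q ^+ i != 1) -> qpoch q a k != 0.
Proof.
by move=> h; apply/prodf_neq0 => i _; rewrite subr_eq0 eq_sym h.
Qed.

Lemma qpoch_eq0 a k i : (i < k)%N -> a * q ^+ i = 1 -> qpoch q a k = 0.
Proof.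
move=> ik e; apply/eqP/prodf_eq0; exists (Ordinal ik) => //.
by rewrite subr_eq0 e.
Qed.

Lemma qpoch_q_neq0 k : qpoch q q k != 0.
Proof. by apply: qpoch_neq0 => i _; rewrite -exprS q_n1. Qed.

Lemma subr1X_neq0 i : 1 - q ^+ i.+1 != 0.
Proof. by rewrite subr_eq0 eq_sym q_n1. Qed.

Lemma qphi0 a : qphi q a 0 = 1.
Proof. by rewrite /qphi big_ord0. Qed.

Definition linphi a : {poly F} := 1 - (2 * a) *: 'X + (a ^+ 2)%:P.

Lemma qphiS a k : qphi q a k.+1 = qphi q a k * linphi (a * q ^+ k).
Proof.
by rewrite /qphi big_ord_recr /= /linphi exprMn -exprM mulrA (mulnC 2).
Qed.

Lemma qphiSl a k : qphi q a k.+1 = linphi a * qphi q (a * q) k.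
Proof.
rewrite /qphi big_ord_recl; congr (_ * _).
  by rewrite /linphi muln0 !expr0 !mulr1.
apply: eq_bigr => i _ /=; rewrite !mulnS !exprD !exprS expr0 mulr1.
by congr (1 - _ *: _ + _%:P); ring.
Qed.

(** Both polynomials are affine in x, so two coefficients must match: the scalars u and v satisfy u
    a + v b = 0, which removes 'X, and are normalised by the constant term. *)
Lemma linphi_unity a b : a != 0 -> b != 0 -> a != b -> a * b != 1 ->
  ((1 - a * b) * (1 - a / b))^-1 *: linphi a
    + ((1 - a * b) * (1 - b / a))^-1 *: linphi b = 1.
Proof.
move=> a0 b0 ab ab1.
have h1 : 1 - a * b != 0 by rewrite subr_eq0 eq_sym.
have h2 : a - b != 0 by rewrite subr_eq0.
have h3 : b - a != 0 by rewrite subr_eq0 eq_sym.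
apply/polyP => i; rewrite /linphi !coefE.
by case: i => [|[|i]] /=; field; rewrite h1 h2 h3 a0 b0.
Qed.

(** * Genericity and the recurrences of the weights *)

(** The part of H1 that keeps the weights of degree [n] free of zero denominators. Two natural
    exponents stand for one integer exponent between -n and n, so that passing from [a] to [a * q]
    is a mere shift of [i]. *)
Definition generic_pair a b n :=
  [/\ a != 0, b != 0, forall i, (i < n)%N -> a * b * q ^+ i != 1
    & forall i j, (i <= n)%N -> (j <= n)%N -> a * q ^+ i != b * q ^+ j].

Lemma generic_pairS a b n : generic_pair a b n.+1 -> generic_pair a b n.
Proof.
case=> a0 b0 h1 h2; split=> // [i hi|i j hi hj]; first exact/h1/ltnW.
by apply: h2; apply: leqW.
Qed.

Lemma generic_pair_shift a b n :
  generic_pair a b n.+1 -> generic_pair (a * q) b n.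
Proof.
case=> a0 b0 h1 h2; split=> //; first by rewrite mulf_neq0.
  by move=> i hi; rewrite (mulrAC a) -(mulrA (a * b)) -exprS h1.
by move=> i j hi hj; rewrite -mulrA -exprS h2 // leqW.
Qed.

(* [weight a b k r] is 'C(n, k) * pi_{n,k} for n = k + r; taking (k, r) as
   arguments avoids truncated subtraction and integer exponents. *)
Definition weight a b k r :=
  qpoch q q (k + r) / (qpoch q q k * qpoch q q r)
  * ((a * q ^+ k - b * q ^+ r)
     / (a * (qpoch q (a * b) (k + r) * qpoch q (b / a) r.+1
        * qpoch q (a / b * q) k))).


Lemma generic_lower a b r n : generic_pair a b n -> (r <= n)%N ->
  qpoch q (b / a) r.+1 != 0.
Proof.
case=> a0 b0 _ h2 hr; apply: qpoch_neq0 => i hi.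
have := h2 0%N i (leq0n _) (leq_trans (hi : (i <= r)%N) hr).
apply: contraNneq => e.
by rewrite expr0 -e; apply/eqP; field.
Qed.

Lemma generic_upper a b k n : generic_pair a b n -> (k <= n)%N ->
  qpoch q (a / b * q) k != 0.
Proof.
case=> a0 b0 _ h2 hk; apply: qpoch_neq0 => i hi.
have := h2 i.+1 0%N (leq_trans hi hk) (leq0n _); apply: contraNneq => e.
by rewrite expr0 -e exprS; apply/eqP; field.
Qed.

(** Lifting the [(k, r)] term by its [linphi (a * q ^+ k)] summand lands on [(k.+1, r)]; the last
    factor on the right is the share of the new weight supplied this way. It becomes [up k.+1] in
    [weight_unity]. *)
Lemma weight_up a b k r : generic_pair a b (k + r).+1 ->
  weight a b k r
    * ((1 - a * q ^+ k * (b * q ^+ r)) * (1 - a * q ^+ k / (b * q ^+ r)))^-1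
  = weight a b k.+1 r
    * ((1 - q ^+ k.+1) * q ^+ r * (a * q ^+ k.+1 - b)
       / ((1 - q ^+ (k + r).+1) * (a * q ^+ k.+1 - b * q ^+ r))).
Proof.
move=> hg; case: (hg) => a0 b0 h1 h2.
have lo : qpoch q (b / a) r.+1 != 0 by apply: (generic_lower hg); lia.
have up : qpoch q (a / b * q) k.+1 != 0 by apply: (generic_upper hg); lia.
have mi : qpoch q (a * b) (k + r).+1 != 0 by apply: qpoch_neq0.
have e1 : a * q ^+ k - b * q ^+ r != 0 by rewrite subr_eq0 h2 //; lia.
have e2 : a * q ^+ k.+1 - b * q ^+ r != 0 by rewrite subr_eq0 h2 //; lia.
have e3 := subr1X_neq0 (k + r); have e4 := subr1X_neq0 k.
have p1 := qpoch_q_neq0 k; have p2 := qpoch_q_neq0 r.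
have p3 := qpoch_q_neq0 (k + r).
have qk : q ^+ k != 0 by rewrite expf_neq0.
have qr : q ^+ r != 0 by rewrite expf_neq0.
move: up mi e2 e3 e4; rewrite /weight addSn.
rewrite (qpochS (a / b * q)) (qpochS (a * b)) !(qpochS q) !exprS exprD.
rewrite !mulf_eq0 !negb_or => /andP[u1 u2] /andP[m1 m2] e2 e3 e4.
(* [field] clears the inner quotients and asks for these forms of conditions already at hand. *)
have u3 : b - a * q * q ^+ k != 0.
  apply: contraNneq u2 => /eqP; rewrite subr_eq0 => /eqP e.
  by apply/eqP; rewrite e; field; rewrite qk q0 a0.
have u4 : b * q ^+ r - a * q ^+ k != 0 by rewrite -opprB oppr_eq0.
have m3 : 1 - a * q ^+ k * (b * q ^+ r) != 0.
  by rewrite mulrACA mulrA -mulrA.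
field.
by rewrite ?a0 ?b0 ?qk ?qr ?p1 ?p2 ?p3 ?lo ?u1 ?m1 ?m2 ?e1 ?e2 ?e3 ?e4
  ?u3 ?u4 ?m3.
Qed.

(** The companion share: the [linphi (b * q ^+ r)] summand lands on [(k, r.+1)], and the last factor
    becomes [dn k]. *)
Lemma weight_down a b k r : generic_pair a b (k + r).+1 ->
  weight a b k r
    * ((1 - a * q ^+ k * (b * q ^+ r)) * (1 - b * q ^+ r / (a * q ^+ k)))^-1
  = weight a b k r.+1
    * ((1 - q ^+ r.+1) * q ^+ k * (a - b * q ^+ r.+1)
       / ((1 - q ^+ (k + r).+1) * (a * q ^+ k - b * q ^+ r.+1))).
Proof.
move=> hg; case: (hg) => a0 b0 h1 h2.
have lo : qpoch q (b / a) r.+2 != 0 by apply: (generic_lower hg); lia.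
have up : qpoch q (a / b * q) k != 0 by apply: (generic_upper hg); lia.
have mi : qpoch q (a * b) (k + r).+1 != 0 by apply: qpoch_neq0.
have e1 : a * q ^+ k - b * q ^+ r != 0 by rewrite subr_eq0 h2 //; lia.
have e2 : a * q ^+ k - b * q ^+ r.+1 != 0 by rewrite subr_eq0 h2 //; lia.
have u3 : a - b * q ^+ r.+1 != 0.
  by have := h2 0%N r.+1; rewrite expr0 mulr1 subr_eq0; apply; lia.
have e3 := subr1X_neq0 (k + r); have e4 := subr1X_neq0 r.
have p1 := qpoch_q_neq0 k; have p2 := qpoch_q_neq0 r.
have p3 := qpoch_q_neq0 (k + r).
have qk : q ^+ k != 0 by rewrite expf_neq0.
have qr : q ^+ r != 0 by rewrite expf_neq0.
move: lo mi e2 e3 e4 u3; rewrite /weight addnS.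
rewrite (qpochS (b / a) r.+1) (qpochS (a * b)) !(qpochS q) !exprS exprD.
rewrite !mulf_eq0 !negb_or => /andP[u1 u2] /andP[m1 m2] e2 e3 e4 u3.
have m3 : 1 - a * q ^+ k * (b * q ^+ r) != 0.
  by rewrite mulrACA mulrA -mulrA.
field.
by rewrite ?a0 ?b0 ?qk ?qr ?p1 ?p2 ?p3 ?up ?u1 ?m1 ?m2 ?e1 ?e2 ?e3 ?e4 ?u3 ?m3.
Qed.

(** * The partition of unity *)

Lemma weight_unity a b n : generic_pair a b n ->
  \sum_(k < n.+1) weight a b k (n - k) *: (qphi q a k * qphi q b (n - k)) = 1.
Proof.
elim: n => [|n IH] hg.
  case: (hg) => a0 b0 _ /(_ 0%N 0%N isT isT); rewrite !expr0 !mulr1 => ab.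
  rewrite big_ord_recl big_ord0 addr0 /weight !qphi0 !qpochS !qpoch0 mulr1.
  rewrite [X in X *: _](_ : _ = 1) ?scale1r ?mulr1 //; field.
  by rewrite a0 subr_eq0 ab oner_eq0.
rewrite -(IH (generic_pairS hg)).
pose N := n.+1; pose den k := (1 - q ^+ N) * (a * q ^+ k - b * q ^+ (N - k)).
(* In degree [N], the weight at [k] receives the share [up k] from index [k - 1] and the share
   [dn k] from index [k] of degree [n]. *)
pose up k := (1 - q ^+ k) * q ^+ (N - k) * (a * q ^+ k - b) / den k.
pose dn k := (1 - q ^+ (N - k)) * q ^+ k * (a - b * q ^+ (N - k)) / den k.
pose P k := qphi q a k * qphi q b (N - k).
have split k : (k <= N)%N -> up k + dn k = 1.
  move=> kN; case: (hg) => _ _ _ h2.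
  have := h2 k (N - k)%N kN (leq_subr _ _); rewrite -subr_eq0 => e1.
  have := subr1X_neq0 n; rewrite /up /dn /den -[n.+1]/N.
  have -> : q ^+ N = q ^+ k * q ^+ (N - k) by rewrite -exprD subnKC.
  move=> e2; field.
  by rewrite e1 e2.
transitivity (\sum_(k < n.+2) (weight a b k (N - k) * up k) *: P k
              + \sum_(k < n.+2) (weight a b k (N - k) * dn k) *: P k).
  rewrite -big_split; apply: eq_bigr => k _ /=.
  by rewrite -scalerDl -mulrDr split ?mulr1 // -ltnS.
(* [up] vanishes at 0 and [dn] vanishes at [N]. Dropping these end terms leaves two sums over
   [k <= n], the first with its index shifted by one. *)
rewrite big_ord_recl {1}/up expr0 subrr !mul0r mulr0 scale0r add0r.
rewrite [X in _ + X = _]big_ord_recr /= {2}/dn subnn expr0.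
rewrite subrr !mul0r mulr0 scale0r addr0.
rewrite -big_split; apply: eq_bigr => k _ /=; rewrite /bump leq0n add1n.
have kn : (k <= n)%N by rewrite -ltnS.
set r := (n - k)%N; have En : n = (k + r)%N by rewrite subnKC.
have hgkr : generic_pair a b (k + r).+1 by rewrite -En.
have -> : (N - k.+1)%N = r by rewrite /N subSS.
have -> : (N - k)%N = r.+1 by rewrite /N subSn.
have -> : up k.+1 = (1 - q ^+ k.+1) * q ^+ r * (a * q ^+ k.+1 - b)
       / ((1 - q ^+ (k + r).+1) * (a * q ^+ k.+1 - b * q ^+ r)).
  by rewrite /up /den /N subSS -En.
have -> : dn k = (1 - q ^+ r.+1) * q ^+ k * (a - b * q ^+ r.+1)
       / ((1 - q ^+ (k + r).+1) * (a * q ^+ k - b * q ^+ r.+1)).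
  by rewrite /dn /den /N subSn // -En.
rewrite -weight_up // -weight_down // /P /N subSS subSn // -/r.
rewrite !qphiS -[in RHS](mulr1 (_ * qphi q b r)).
case: (hg) => a0 b0 h1 h2.
rewrite -(@linphi_unity (a * q ^+ k) (b * q ^+ r)).
- by rewrite -!mul_polyC !rmorphM /=; ring.
- by rewrite mulf_neq0 ?expf_neq0.
- by rewrite mulf_neq0 ?expf_neq0.
- by apply: h2; lia.
by rewrite mulrACA -exprD -En h1.
Qed.

(** * Expansion of [qphi q a j] in the basis *)

(** Both sides are the coefficient of phi_{k+1}(x; a) phi_r(x; b) in phi_1(x; a): on the right from
    multiplying the unity identity for [(a * q, b)] by phi_1(x; a), on the left from the case j = 1
    of [qphi_expand]. *)
Lemma weight_shift a b k r : generic_pair a b (k + r).+1 ->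
  (1 - a * b) * weight a b k.+1 r
    * ((1 - q ^- k.+1) * (1 - a / b * q ^- r) / (1 - q ^- (k + r).+1))
  = weight (a * q) b k r.
Proof.
move=> hg; case: (hg) => a0 b0 h1 h2.
have lo : qpoch q (b / a) r.+1 != 0 by apply: (generic_lower hg); lia.
have up : qpoch q (a / b * q) k.+1 != 0 by apply: (generic_upper hg); lia.
have lo' : qpoch q (b / (a * q)) r.+1 != 0.
  by apply: (generic_lower (generic_pair_shift hg)); lia.
have mi : qpoch q (a * b) (k + r).+1 != 0 by apply: qpoch_neq0.
have e2 : a * q ^+ k.+1 - b * q ^+ r != 0 by rewrite subr_eq0 h2 //; lia.
have ba : b / a = b / (a * q) * q by field; rewrite a0 q0.
(* The product of length [r.+2] starting at b / (a q) is split at its first and at its last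
   factor. *)
have lor : qpoch q (b / a) r.+1 =
  qpoch q (b / (a * q)) r.+1 * (1 - b / (a * q) * q ^+ r.+1)
    / (1 - b / (a * q)).
  have nz : 1 - b / (a * q) != 0.
    by move: lo'; rewrite qpochSl mulf_eq0 negb_or => /andP[].
  apply: (mulIf nz); rewrite mulfVK // -qpochS [RHS]qpochSl -ba mulrC //.
have aqb : a * q - b != 0.
  by have := h2 1%N 0%N; rewrite expr0 mulr1 subr_eq0; apply; lia.
have abr : a - b * q ^+ r != 0.
  by have := h2 0%N r; rewrite expr0 mulr1 subr_eq0; apply; lia.
have p1 := qpoch_q_neq0 k; have p2 := qpoch_q_neq0 r.
have p3 := qpoch_q_neq0 (k + r).
have qk : q ^+ k != 0 by rewrite expf_neq0.
have qr : q ^+ r != 0 by rewrite expf_neq0.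
have e3 := subr1X_neq0 (k + r); have e4 := subr1X_neq0 k.
have e5 : q * (q ^+ k * q ^+ r) - 1 != 0.
  by rewrite -oppr_eq0 opprB -exprD -exprS.
move: mi up e2 e3 e4.
rewrite /weight addSn lor (qpochSl (a * b)) (qpochSl (a / b * q)) !(qpochS q).
rewrite (mulrAC a q b) (mulrAC a q b^-1) !exprS exprD !mulf_eq0 !negb_or.
set L := qpoch q (b / (a * q)) r.+1 in lo' *.
move=> /andP[m1 m2] /andP[u1 u2] e2 e3 e4.
have u3 : b - a * q != 0 by rewrite -opprB oppr_eq0.
field.
rewrite ?a0 ?b0 ?qk ?qr ?p1 ?p2 ?p3 ?lo' ?u1 ?u2 ?u3 ?m1 ?m2 ?e2 ?e3 ?e4 ?e5.
by rewrite q0 aqb abr.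
Qed.

Lemma qphi_expand j n a b : generic_pair a b n -> (j <= n)%N ->
  qphi q a j = qpoch q (a * b) j *: \sum_(k < n.+1)
    (weight a b k (n - k)
     * (qpoch q (q ^- k) j * qpoch q (a / b * q ^- (n - k)) j
        / qpoch q (q ^- n) j))
    *: (qphi q a k * qphi q b (n - k)).
Proof.
elim: j n a => [|j IH] n a hg jn.
  rewrite qphi0 qpoch0 scale1r -(weight_unity hg); apply: eq_bigr => k _.
  by rewrite !qpoch0 divr1 !mulr1.
case: n hg jn => // n hg jn.
rewrite qphiSl (IH n _ (generic_pair_shift hg) jn) [in RHS]big_ord_recl /=.
(* The term k = 0 contains (1; q)_{j+1} = 0; the remaining indices are [k.+1] and match those of
   degree [n]. *)
rewrite (@qpoch_eq0 (q ^- 0) j.+1 0) ?expr0 ?invr1 ?mulr1 //.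
rewrite !mul0r mulr0 scale0r add0r (qpochSl (a * b)) (mulrC (1 - _)).
rewrite -scalerA -scalerAr.
rewrite (mulrAC a q b); congr (_ *: _).
rewrite mulr_sumr scaler_sumr; apply: eq_bigr => k _.
rewrite /bump leq0n add1n subSS; set r := (n - k)%N.
have En : n = (k + r)%N by rewrite subnKC // -ltnS.
rewrite -weight_shift -?En // qphiSl -scalerAr scalerA mulrA.
congr (_ *: _).
(* The first factors of the three symbols form the quotient in [weight_shift]; the remaining factors
   are the symbols of length [j] for [(a * q, b)]. *)
rewrite (mulrAC a q) !qpochSl.
have -> : q ^- k.+1 * q = q ^- k.
  by rewrite exprS invfM mulrC mulVKf.
have -> : q ^- n.+1 * q = q ^- n.
  by rewrite exprS invfM mulrC mulVKf.
rewrite (mulrAC (a / b) q).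
by rewrite invfM; ring.
by rewrite mulrA.
Qed.

(** * Expansion of the Askey-Wilson polynomials *)

Lemma phi43_widen N M (a1 a2 a3 a4 b1 b2 b3 z : F) : (N <= M)%N ->
  (forall j, (N < j)%N -> qpoch q a3 j = 0) ->
  phi43 N a1 a2 a3 a4 b1 b2 b3 q z = phi43 M a1 a2 a3 a4 b1 b2 b3 q z.
Proof.
move=> NM h; rewrite /phi43 (big_ord_widen M.+1 (fun j =>
  (qpoch q a1 j * qpoch q a2 j * qpoch q a3 j * qpoch q a4 j)
    / (qpoch q q j * qpoch q b1 j * qpoch q b2 j * qpoch q b3 j) * z ^+ j)) //.
rewrite big_mkcond; apply: eq_bigr => j _; case: ltnP => // jN.
by rewrite (h j) // mulr0 !mul0r.
Qed.

(** Since (q^-k; q)_j = 0 for j > k, every series can be cut at [m], independently of [k]; this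
    makes the sums over [j] and [k] exchangeable. *)
Lemma phi43_cut m k (a1 a2 a4 b1 b2 b3 z : F) :
  phi43 (minn m k) a1 a2 (q ^- k) a4 b1 b2 b3 q z =
  phi43 m a1 a2 (q ^- k) a4 b1 b2 b3 q z.
Proof.
case: (leqP m k) => // km; apply: phi43_widen => [|j kj]; first exact: ltnW.
by apply: (@qpoch_eq0 _ _ k) => //; rewrite mulVf ?expf_neq0.
Qed.

Lemma askey_wilson_expand a b c d n m (z : F) : (2 : F) != 0 ->
  generic_pair a b n -> (m <= n)%N -> z != 0 ->
  askey_wilson q a b c d m z = \sum_(k < n.+1)
    weight a b k (n - k) * omega_coef q a b c d m
    * phi43 (minn m k) (q ^- m) (a * b * c * d * q ^ (m%:Z - 1))
        (q ^- k) (a / b * q ^- (n - k)) (a * d) (a * c) (q ^- n) q q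
    * (qphi q a k * qphi q b (n - k)).[(z + z^-1) / 2].
Proof.
move=> n2 hg mn z0.
under eq_bigr do rewrite phi43_cut /phi43 mulr_sumr mulr_suml.
rewrite exchange_big /= /askey_wilson /phi43 mulr_sumr; apply: eq_bigr => j _.
have jn : (j <= n)%N by apply: leq_trans mn; rewrite -ltnS.
rewrite -(mulrA (_ * _) (qpoch q (a * z) j)) -qphiE // (qphi_expand hg jn).
(* The factor (ab; q)_j from [qphi_expand] cancels the lower parameter [a * b] of p_m, and (q^-n;
   q)_j takes its place. *)
have ab0 : qpoch q (a * b) j != 0.
  case: hg => _ _ h1 _; apply: qpoch_neq0 => i ij.
  by rewrite h1 // (leq_trans ij jn).
rewrite hornerZ horner_sum !mulr_sumr mulr_suml mulr_suml mulr_sumr.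
apply: eq_bigr => k _; rewrite hornerZ /omega_coef.
set v := _.[_]; set rhs := RHS; rewrite -[rhs]mul1r -(mulfV ab0) /rhs !invfM.
by ring.
Qed.

(** * Linear independence of the basis *)

Lemma qphi_free a b n (e : nat -> F) : (2 : F) != 0 -> generic_pair a b n ->
  (forall i, (0 < i < 2 * n)%N -> a ^+ 2 * q ^+ i != 1) ->
  (forall z, z != 0 -> \sum_(k < n.+1)
     e k * (qphi q a k * qphi q b (n - k)).[(z + z^-1) / 2] = 0) ->
  forall k, (k <= n)%N -> e k = 0.
Proof.
move=> n2 [a0 b0 h1 h2] h3 he; elim/ltn_ind => k IH kn.
have qk : q ^+ k != 0 by rewrite expf_neq0.
have z0 : (a * q ^+ k)^-1 != 0 by rewrite invr_eq0 mulf_neq0.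
have := he _ z0; rewrite (bigD1 (Ordinal (kn : k < n.+1)%N)) //=.
rewrite big1 ?addr0 => [|i ik].
  move/eqP; rewrite mulf_eq0 => /orP[/eqP //|].
  rewrite hornerM !qphiE // invrK !mulf_eq0 -!orbA => h.
  suff: false by []; apply: contraTT h => _; rewrite !negb_or.
  (* At this point az, a/z, bz, b/z are q^-k, a^2 q^k, b / (a q^k), ab q^k. In the second symbol the
     exponent [k + i] with [i < k <= n] lies strictly between 0 and 2n. *)
  apply/and4P; split; apply: qpoch_neq0 => i ik.
  - have -> : a / (a * q ^+ k) = q ^- k by field; rewrite a0 qk.
    apply: contraNneq (q_n1 (i := (k - i)%N) _) => [e1|]; last first.
      by rewrite subn_gt0.
    apply/eqP/(mulIf (expf_neq0 i q0)); rewrite mul1r -exprD subnK 1?ltnW //.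
    by rewrite -[LHS]mulr1 -e1 mulVKf.
  - have -> : a * (a * q ^+ k) * q ^+ i = a ^+ 2 * q ^+ (k + i).
      by rewrite exprD; ring.
    by apply: h3; lia.
  - apply: contraNneq (h2 k i kn _) => [e1|]; last by lia.
    by rewrite -[_ * q ^+ k]mulr1 -e1; apply/eqP; field; rewrite a0 qk.
  - have -> : b * (a * q ^+ k) * q ^+ i = a * b * q ^+ (k + i).
      by rewrite exprD; ring.
    by apply: h1; lia.
rewrite hornerM !qphiE // -mulrA.
(* Lower coefficients are zero by induction; for i > k the factor of index [k] in (q^-k; q)_i
   vanishes. *)
case: (ltnP i k) => [ik'|ki]; first by rewrite IH ?mul0r // -ltnS.
rewrite (@qpoch_eq0 (a / (a * q ^+ k)) i k) ?mul0r ?mulr0 //.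
  by rewrite ltn_neqAle ki eq_sym andbT.
by field; rewrite a0 qk.
Qed.

(** * Closed forms of the weights and the q-Racah parameters *)

Lemma exprz_subn k n : (k <= n)%N -> q ^ (k%:Z - n%:Z) = q ^- (n - k).
Proof. by move=> kn; rewrite -opprB subzn // -exprnN. Qed.

(** With r = n - k, a q^k - b q^r = a q^k (1 - (b/a) q^{n-2k}), and the last factor of (b/a;
    q)_{r+1} is 1 - (b/a) q^r. *)
Lemma pi_coefE a b n k : generic_pair a b n -> (k <= n)%N ->
  'C(n, k)%:R != 0 :> F ->
  'C(n, k)%:R * pi_coef q a b n k = weight a b k (n - k).
Proof.
move=> hg kn C0; case: (hg) => a0 b0 h1 h2; rewrite /pi_coef /weight /qbinom.
have lo := generic_lower (r := (n - k)%N) hg (leq_subr _ _).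
have up := generic_upper hg kn.
rewrite subnKC //.
have -> : q ^ (n%:Z - (2 * k)%:Z) = q ^+ (n - k) / q ^+ k.
  rewrite mul2n -addnn PoszD opprD addrA subzn // expfzDr //.
  by rewrite -exprnN.
have qk : q ^+ k != 0 by rewrite expf_neq0.
have p1 := qpoch_q_neq0 k; have p2 := qpoch_q_neq0 (n - k).
have mi : qpoch q (a * b) n != 0 by apply: qpoch_neq0.
have := lo; rewrite qpochS mulf_eq0 negb_or => /andP[l1 l2].
have l3 : a - b * q ^+ (n - k) != 0.
  have := h2 0%N (n - k)%N (leq0n _) (leq_subr _ _).
  by rewrite expr0 mulr1 subr_eq0.
field.
by rewrite a0 up l3 l1 mi p2 p1 qk C0.
Qed.

Lemma pi_coef0 a b n : generic_pair a b n ->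
  pi_coef q a b n 0 = (qpoch q (b / a) n * qpoch q (a * b) n)^-1.
Proof.
move=> hg; case: (hg) => a0 b0 h1 h2.
transitivity (weight a b 0 (n - 0)).
  by rewrite -pi_coefE ?bin0 ?oner_eq0 // mul1r.
have := generic_lower hg (leqnn n).
rewrite subn0 /weight add0n !qpoch0 expr0 qpochS mulf_eq0 negb_or.
case/andP=> l1 _; have p := qpoch_q_neq0 n.
have mi : qpoch q (a * b) n != 0 by apply: qpoch_neq0.
have l3 : a - b * q ^+ n != 0.
  by have := h2 0%N n (leq0n _) (leqnn _); rewrite expr0 mulr1 subr_eq0.
field.
by rewrite mi l1 a0 l3 p.
Qed.

Lemma pi_coefn a b n : generic_pair a b n ->
  pi_coef q a b n n = (qpoch q (a / b) n * qpoch q (a * b) n)^-1.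
Proof.
move=> hg; case: (hg) => a0 b0 h1 h2.
transitivity (weight a b n (n - n)).
  by rewrite -pi_coefE ?binn ?oner_eq0 // mul1r.
have up := generic_upper hg (leqnn n).
rewrite subnn /weight addn0 qpochS !qpoch0 expr0 !mulr1.
have ab : a - b != 0.
  by have := h2 0%N 0%N (leq0n _) (leq0n _); rewrite !mulr1 subr_eq0.
have ba : b - a != 0 by rewrite -opprB oppr_eq0.
have p := qpoch_q_neq0 n.
have mi : qpoch q (a * b) n != 0 by apply: qpoch_neq0.
have abq : a * q ^+ n - b != 0.
  by have := h2 n 0%N (leqnn _) (leq0n _); rewrite mulr1 subr_eq0.
have -> : qpoch q (a / b) n =
    (1 - a / b) * qpoch q (a / b * q) n / (1 - a / b * q ^+ n).
  rewrite -qpochSl qpochS mulfK //.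
  apply: contraNneq abq => /eqP; rewrite subr_eq0 => /eqP e.
  by apply/eqP; rewrite -[X in _ - X]mulr1 e; field.
have baq : b - a * q ^+ n != 0 by rewrite -opprB oppr_eq0.
field.
by rewrite b0 baq mi up ba a0 ab p.
Qed.

(** The parameter dictionary: alpha beta q^2 = abcd, beta delta q = ac, gamma q = q^-n. *)
Lemma qracahE a b c d n m k : b != 0 -> (k <= n)%N ->
  qracah q (a * d / q) (b * c / q) (q ^- n.+1) (a / b) m k =
  phi43 (minn m k) (q ^- m) (a * b * c * d * q ^ (m%:Z - 1)) (q ^- k)
    (a / b * q ^- (n - k)) (a * d) (a * c) (q ^- n) q q.
Proof.
move=> b0 kn; rewrite /qracah; congr phi43.
- by rewrite expfzDr // exprN1 exprS -exprnP; field.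
- rewrite -{1}(subnK kn) -addnS exprD; field.
  by rewrite b0 !expf_neq0.
- by rewrite mulfVK.
- by field; rewrite b0.
- by rewrite exprS; field; rewrite expf_neq0.
Qed.

(** Only the term j = 0 survives. This value and [qracah_0k] isolate [pi_coef] and [omega_coef] in
    the product formula. *)
Lemma qracah_m0 (al be ga de : F) k : qracah q al be ga de 0 k = 1.
Proof.
by rewrite /qracah min0n /phi43 big_ord1 !qpoch0 expr0 !mulr1 divr1.
Qed.

Lemma qracah_0k (al be ga de : F) m : qracah q al be ga de m 0 = 1.
Proof.
by rewrite /qracah minn0 /phi43 big_ord1 !qpoch0 expr0 !mulr1 divr1.
Qed.

(** * Existence and uniqueness of the connection coefficients *)

Lemma bernstein_unity a b n : generic_pair a b n ->
  (forall k, (k <= n)%N -> 'C(n, k)%:R != 0 :> F) ->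
  \sum_(k < n.+1) pi_coef q a b n k *: bernstein q a b n k = 1.
Proof.
move=> hg C0; rewrite -(weight_unity hg); apply: eq_bigr => k _.
have kn : (k <= n)%N by rewrite -ltnS.
by rewrite -(pi_coefE hg kn (C0 _ kn)) /bernstein scalerA mulrC.
Qed.

Lemma connection_coefs_pi a b c d n : (2 : F) != 0 -> generic_pair a b n ->
  (forall k, (k <= n)%N -> 'C(n, k)%:R != 0 :> F) ->
  connection_coefs q a b c d n (fun k m =>
    pi_coef q a b n k * omega_coef q a b c d m
    * qracah q (a * d / q) (b * c / q) (q ^- n.+1) (a / b) m k).
Proof.
move=> n2 hg C0 m mn z z0; rewrite (askey_wilson_expand _ _ n2 hg mn z0).
apply: eq_bigr => k _; have kn : (k <= n)%N by rewrite -ltnS.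
case: (hg) => _ b0 _ _.
rewrite qracahE // -(pi_coefE hg kn (C0 _ kn)) /bernstein hornerZ.
by rewrite !mulrA; congr (_ * _); rewrite -!mulrA [RHS]mulrCA; ring.
Qed.

Lemma connection_coefs_uniq a b c d n (A B : nat -> nat -> F) :
  (2 : F) != 0 -> generic_pair a b n ->
  (forall i, (0 < i < 2 * n)%N -> a ^+ 2 * q ^+ i != 1) ->
  (forall k, (k <= n)%N -> 'C(n, k)%:R != 0 :> F) ->
  connection_coefs q a b c d n A -> connection_coefs q a b c d n B ->
  forall k m, (k <= n)%N -> (m <= n)%N -> A k m = B k m.
Proof.
move=> n2 hg h3 C0 hA hB k m kn mn.
(* The binomial factor of [bernstein] is moved into the coefficient, where it can be cancelled
   afterwards. *)
pose e k := (A k m - B k m) * 'C(n, k)%:R.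
suff /eqP : e k = 0 by rewrite mulf_eq0 (negPf (C0 _ kn)) orbF subr_eq0 => /eqP.
apply: (qphi_free (e := e) n2 hg h3 _ kn) => z z0.
transitivity (\sum_(k < n.+1) (A k m * (bernstein q a b n k).[(z + z^-1) / 2]
   - B k m * (bernstein q a b n k).[(z + z^-1) / 2])).
  by apply: eq_bigr => i _; rewrite /e /bernstein hornerZ; ring.
by rewrite sumrB -hA // -hB // subrr.
Qed.
End Bernstein.

(** * Specialisation to complex parameters and real q *)

Local Open Scope complex_scope.

Theorem theorem5p4 (R : realType) (q : R) (a b c d : R[i]) (n : nat)
  (hq : 0 < q < 1) (hn : (1 <= n)%N)
  (ha : a != 0) (hb : b != 0) (hc : c != 0) (hd : d != 0)
  (H1a : forall j : int, - n.+1%:Z <= j <= n.+1%:Z -> a / b != q%:C ^ j)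
  (H1b : forall j : nat, (j <= n - 1)%N -> a * b != q%:C ^- j)
  (H1c : forall j : nat, (1 <= j <= 2 * n - 1)%N ->
     a ^+ 2 != q%:C ^- j /\ b ^+ 2 != q%:C ^- j)
  (H2 : forall j : nat, (j <= n - 1)%N ->
     [/\ a * c != q%:C ^- j, a * d != q%:C ^- j,
         b * c != q%:C ^- j & b * d != q%:C ^- j])
  (H3 : forall j : nat, (1 <= j <= 2 * n - 1)%N ->
     a * b * c * d != q%:C ^ (1 - j%:Z)) :
  let Q := q%:C in
  let alpha := a * d / Q in
  let beta := b * c / Q in
  let gamma := Q ^- n.+1 in
  let delta := a / b in
  (forall k, (k <= n)%N ->
     mu Q gamma delta k = Q ^- k + a / b * Q ^ (k%:Z - n%:Z))
  /\ (exists A : nat -> nat -> R[i], connection_coefs Q a b c d n A)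
  /\ (forall A : nat -> nat -> R[i], connection_coefs Q a b c d n A ->
      (forall k m, (k <= n)%N -> (m <= n)%N ->
         A k m = pi_coef Q a b n k * omega_coef Q a b c d m
                 * qracah Q alpha beta gamma delta m k)
      /\ (forall k, (k <= n)%N -> pi_coef Q a b n k = A k 0%N)
      /\ A 0%N 0%N != 0
      /\ (forall m, (m <= n)%N ->
            omega_coef Q a b c d m = A 0%N m / A 0%N 0%N))
  /\ (forall k m, (k <= n)%N -> (m <= n)%N ->
        qracah Q alpha beta gamma delta m k =
        phi43 (minn m k)
          (Q ^- m) (a * b * c * d * Q ^ (m%:Z - 1)) (Q ^- k)
          (a / b * Q ^ (k%:Z - n%:Z))
          (a * d) (a * c) (Q ^- n) Q Q)
  /\ \sum_(k < n.+1) pi_coef Q a b n k *: bernstein Q a b n k = 1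
  /\ pi_coef Q a b n 0 = (qpoch Q (b / a) n * qpoch Q (a * b) n)^-1
  /\ pi_coef Q a b n n = (qpoch Q (a / b) n * qpoch Q (a * b) n)^-1.
Proof.
move=> Q alpha beta gamma delta.
have [q_gt0 q_lt1] := andP hq.
have Q0 : Q != 0 by rewrite fmorph_eq0 gt_eqF.
have Q1 i : (0 < i)%N -> Q ^+ i != 1.
  move=> i0; rewrite -rmorphXn -(rmorph1 (real_complex R)).
  rewrite (inj_eq (fmorph_inj _)) lt_eqF // exprn_ilt1 ?ltW // -lt0n //.
have C0 k : (k <= n)%N -> 'C(n, k)%:R != 0 :> R[i].
  by move=> kn; rewrite pnatr_eq0 -lt0n bin_gt0.
have n2 : (2 : R[i]) != 0 by rewrite pnatr_eq0.
have hg : generic_pair Q a b n.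
  split=> // [i hi|i j hi hj].
    have := H1b i; rewrite -ltnS subn1 prednK // => /(_ hi).
    apply: contraNneq => e; apply/eqP/(mulIf (expf_neq0 i Q0)).
    by rewrite e mulVf ?expf_neq0.
  (* An equality a q^i = b q^j would give a / b = q^(j - i), with j - i between -n and n. *)
  have := H1a (j%:Z - i%:Z); rewrite expfzDr // -exprnN => h.
  have /h : (- n.+1%:Z <= j%:Z - i%:Z <= n.+1%:Z)%R by lia.
  apply: contraNneq => e; apply/eqP; rewrite -exprnP.
  apply: (mulIf hb); apply: (mulIf (expf_neq0 i Q0)).
  by rewrite divfK // e mulrAC divfK ?expf_neq0 // mulrC.
have ha2 i : (0 < i < 2 * n)%N -> a ^+ 2 * Q ^+ i != 1.
  move=> hi; have [|+ _] := H1c i; first by lia.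
  apply: contraNneq => e; apply/eqP/(mulIf (expf_neq0 i Q0)).
  by rewrite e mulVf ?expf_neq0.
have hA := connection_coefs_pi Q0 Q1 c d n2 hg C0.
have om0 : omega_coef Q a b c d 0 = 1.
  by rewrite /omega_coef !qpoch0 expr0 invr1 !mulr1.
split; [|split; [|split; [|split; [|split; [|split]]]]].
- move=> k kn; rewrite exprz_subn // /mu /gamma /delta; congr (_ + _).
  rewrite -{1}(subnK kn) -addnS exprD; field.
  by rewrite hb !expf_neq0.
- by eexists; exact: hA.
- move=> A cA.
  have AE k m : (k <= n)%N -> (m <= n)%N -> A k m =
      pi_coef Q a b n k * omega_coef Q a b c d m
      * qracah Q alpha beta gamma delta m k.
    exact: (connection_coefs_uniq Q0 Q1 n2 hg ha2 C0 cA hA).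
  have A0 k : (k <= n)%N -> pi_coef Q a b n k = A k 0%N.
    by move=> kn; rewrite AE // om0 qracah_m0 !mulr1.
  (* The closed form of pi_{n,0} is the inverse of a nonzero product, so dividing by [A 0 0] is
     legitimate. *)
  have pi0 : pi_coef Q a b n 0 != 0.
    rewrite (pi_coef0 Q0 Q1 hg) invr_eq0 mulf_eq0 negb_or.
    rewrite [X in _ && X]qpoch_neq0; last by case: hg.
    rewrite andbT; have := generic_lower hg (leqnn n).
    by rewrite qpochS mulf_eq0 negb_or => /andP[].
  split=> //; split=> //; split; first by rewrite -A0.
  by move=> m mn; rewrite -A0 // AE // qracah_0k mulr1 mulrC mulKf.
- by move=> k m kn _; rewrite (exprz_subn _ kn); exact: qracahE.
- exact: (bernstein_unity Q0 Q1 hg C0).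
- exact: (pi_coef0 Q0 Q1 hg).
- exact: (pi_coefn Q0 Q1 hg).
Qed.
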